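(* Let $R$ be a ring. Every $\pi$-regular element of $R$ is weakly nil clean in $R$. In particular, every $\pi$-regular ring is weakly nil clean.
   Context: Rings are associative with unity, not necessarily commutative. An element $a$ of a ring $R$ is $\pi$-regular if there exist a positive integer $n$ and $r\in R$ such that $a^nra^n=a^n$; the ring $R$ is $\pi$-regular if every element of $R$ is $\pi$-regular. An element $a\in R$ is weakly nil clean in $R$ if there exist an idempotent $e\in R$ and a nilpotent $q\in R$ such that $a-e-q\in eRa$; the ring $R$ is weakly nil clean if every element of $R$ is weakly nil clean in $R$. *)

(* Defs.v *)
From mathcomp Require Import all_boot all_algebra.

Set Implicit Arguments.
Unset Strict Implicit.
Unset Printing Implicit Defensive.

Import GRing.Theory.
Local Open Scope ring_scope.

(* [pzRingType] is the class of associative unital rings, not necessarily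
   commutative and possibly trivial (1 = 0). *)

Definition idempotent_elt (R : pzRingType) (e : R) : Prop := e * e = e.

Definition nilpotent_elt (R : pzRingType) (q : R) : Prop :=
  exists2 n : nat, (0 < n)%N & q ^+ n = 0.

Definition pi_regular_elt (R : pzRingType) (a : R) : Prop :=
  exists2 n : nat, (0 < n)%N & exists r : R, a ^+ n * r * a ^+ n = a ^+ n.

Definition pi_regular_ring (R : pzRingType) : Prop :=
  forall a : R, pi_regular_elt a.

Definition weakly_nil_clean_elt (R : pzRingType) (a : R) : Prop :=
  exists e q : R,
    [/\ idempotent_elt e, nilpotent_elt q
      & exists r : R, a - e - q = e * r * a].

Definition weakly_nil_clean_ring (R : pzRingType) : Prop :=
  forall a : R, weakly_nil_clean_elt a.

(* Main.v *)
(** If [a ^+ n * r * a ^+ n = a ^+ n], take [e := r * a ^+ n] and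
    [q := (1 - e) * a].  The right annihilator [(1 - e)R] of [a ^+ n] is stable
    under left multiplication by [a], so [q ^+ k.+1 = a ^+ k * (1 - e) * a],
    which vanishes for [k = n].  Finally [a - e - q = e * a - e * e], and
    [e] is a left multiple of [a]. *)
Require Import Defs.
From mathcomp Require Import all_boot all_algebra.

Import GRing.Theory.
Local Open Scope ring_scope.

(** Induction on [k]: multiplying by one more [f * a] gives [f * a ^+ k.+1 * f * a], where the
    hypothesis absorbs the leading [f]. *)
Lemma exprS_compl_mul (R : pzRingType) (a f : R) :
  (forall k, f * a ^+ k * f = a ^+ k * f) ->
  forall k, (f * a) ^+ k.+1 = a ^+ k * f * a.
Proof.
move=> stab; elim=> [|k IHk]; first by rewrite expr0 mul1r.
by rewrite exprS IHk -(stab k.+1) exprS !mulrA.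
Qed.

Lemma pi_regular_weakly_nil_clean (R : pzRingType) (a : R) :
  pi_regular_elt a -> weakly_nil_clean_elt a.
Proof.
case=> [[|n] // _ [r reg]].
set e := r * a ^+ n.+1.
have ee : e * e = e by rewrite /e -mulrA [a ^+ n.+1 * _]mulrA reg.
have ann : a ^+ n.+1 * (1 - e) = 0 by rewrite mulrBr mulr1 /e mulrA reg subrr.
(* The discrepancy [e * a ^+ k * (1 - e)] vanishes: powers of [a] commute, which brings [a ^+ n.+1]
   next to [1 - e]. *)
have stab k : (1 - e) * a ^+ k * (1 - e) = a ^+ k * (1 - e).
  rewrite -mulrA mulrBl mul1r {2}/e -mulrA [X in r * X]mulrA -exprD.
  by rewrite addnC exprD -[X in r * X]mulrA ann !mulr0 subr0.
exists e, ((1 - e) * a); split=> //.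
  by exists n.+2 => //; rewrite exprS_compl_mul // ann mul0r.
(* Chosen so that right multiplication by [a] yields [a - e]; this needs the exponent to be a
   successor. *)
exists (1 - r * a ^+ n).
have eE : r * a ^+ n * a = e by rewrite /e exprSr mulrA.
have -> : e * (1 - r * a ^+ n) * a = e * a - e.
  by rewrite -mulrA [(1 - _) * a]mulrBl mul1r eE mulrBr ee.
by rewrite [(1 - e) * a]mulrBl mul1r opprB addrC addrA subrK.
Qed.

Theorem proposition3p2 (R : pzRingType) :
  (forall a : R, pi_regular_elt a -> weakly_nil_clean_elt a) /\
  (pi_regular_ring R -> weakly_nil_clean_ring R).
Proof.
split=> [a|piR a]; first exact: pi_regular_weakly_nil_clean.
exact/pi_regular_weakly_nil_clean/piR.
Qed.
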